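(* Let $Q_4 = [-1,1]^4 \subset \mathbb{R}^4$. There exist non-diagonal critical central hyperplane sections of $Q_4$; that is, there exists a unit vector $\mathbf{a} \in S^3$ which is a critical direction but not a diagonal direction.
   Context: $S^{3}$ is the Euclidean unit sphere of $\mathbb{R}^4$, $\mathbf{a}^\perp = \{\mathbf{x} \in \mathbb{R}^4 : \langle \mathbf{x}, \mathbf{a}\rangle = 0\}$, and $\mathrm{Vol}_{3}$ denotes 3-dimensional volume (Hausdorff measure) in $\mathbb{R}^4$. A unit vector $\mathbf{a} \in S^{3}$ is a critical direction if it is a critical point of the function $V : S^{3} \to \mathbb{R}$, $V(\mathbf{a}) = \mathrm{Vol}_{3}(Q_4 \cap \mathbf{a}^\perp)$, in the usual sense: either $V$ is differentiable at $\mathbf{a}$ (as a function on the sphere) and its differential vanishes there, or $V$ is not differentiable at $\mathbf{a}$. For $1 \leq k \leq 4$, a unit vector in $\mathbb{R}^4$ is a $k$-diagonal direction if, up to permuting the coordinates and changing signs, it is of the form $(\frac{1}{\sqrt k}, \ldots, \frac{1}{\sqrt k}, 0, \ldots, 0)$ with exactly $k$ non-zero coordinates; it is a diagonal direction if it is a $k$-diagonal direction for some $1 \leq k \leq 4$. *)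

(* Defs.v *)
From mathcomp Require Import all_boot all_order all_algebra all_fingroup.
From mathcomp Require Import all_classical all_reals all_analysis.

Set Implicit Arguments.
Unset Strict Implicit.
Unset Printing Implicit Defensive.

Import Order.TTheory GRing.Theory Num.Theory.
Import numFieldNormedType.Exports.

Local Open Scope classical_set_scope.
Local Open Scope ring_scope.

(* The library norm on ['rV[R]_n] is the sup norm, so the Euclidean structure
   is introduced here; both induce the same topology. *)
Definition dotp (R : realType) (n : nat) (x y : 'rV[R]_n) : R :=
  \sum_(i < n) x 0 i * y 0 i.

Definition enorm (R : realType) (n : nat) (x : 'rV[R]_n) : R :=
  Num.sqrt (dotp x x).

Definition sphere (R : realType) (n : nat) : set 'rV[R]_n :=
  [set x : 'rV[R]_n | enorm x = 1].

Definition orth (R : realType) (n : nat) (a : 'rV[R]_n) : set 'rV[R]_n :=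
  [set x : 'rV[R]_n | dotp x a = 0].

Definition cube (R : realType) (n : nat) : set 'rV[R]_n :=
  [set x : 'rV[R]_n | forall i, -1 <= x 0 i <= 1].

(* Adjoining [0] gives the empty set diameter [0] ([ereal_sup set0 = -oo])
   and does not affect nonempty sets. *)
Definition ediam (R : realType) (n : nat) (U : set 'rV[R]_n) : \bar R :=
  ereal_sup (0%E |` [set (enorm (p.1 - p.2))%:E | p in U `*` U]).

Definition is_fine_cover (R : realType) (n : nat) (delta : R)
    (A : set 'rV[R]_n) (U : nat -> set 'rV[R]_n) : Prop :=
  A `<=` \bigcup_i U i /\ forall i, (ediam (U i) <= delta%:E)%E.

(* [pi / 6 * d ^ 3] is the volume of a ball of diameter [d] in dimension 3:
   with this normalisation the 3-dimensional Hausdorff measure is the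
   3-dimensional volume. *)
Definition hausdorff3_pre (R : realType) (n : nat) (delta : R)
    (A : set 'rV[R]_n) : \bar R :=
  ereal_inf [set (\sum_(0 <= i <oo) (pi / 6)%:E * ediam (U i) ^+ 3)%E
            | U in is_fine_cover delta A].

Definition hausdorff3 (R : realType) (n : nat) (A : set 'rV[R]_n) : \bar R :=
  ereal_sup [set hausdorff3_pre delta A | delta in [set d : R | 0 < d]].

Definition section_volume (R : realType) (a : 'rV[R]_4) : R :=
  fine (hausdorff3 (@cube R 4 `&` orth a)).

(* [f] is only looked at on the sphere: it is differentiable at [a] there iff
   it agrees on the sphere with some [F] differentiable at [a] in the ambient
   space, and its differential is then the restriction of ['d F a] to the
   tangent space [orth a], which does not depend on the choice of [F]. *)
Definition sphere_diff_extension (R : realType) (f : 'rV[R]_4 -> R)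
    (a : 'rV[R]_4) (F : 'rV[R]_4 -> R^o) : Prop :=
  (forall x, @sphere R 4 x -> F x = f x) /\ differentiable F a.

Definition sphere_differentiable (R : realType) (f : 'rV[R]_4 -> R)
    (a : 'rV[R]_4) : Prop :=
  exists F, sphere_diff_extension f a F.

Definition sphere_differential_vanishes (R : realType) (f : 'rV[R]_4 -> R)
    (a : 'rV[R]_4) : Prop :=
  forall F, sphere_diff_extension f a F ->
    forall v, orth a v -> 'd F a v = 0.

Definition critical_direction (R : realType) (a : 'rV[R]_4) : Prop :=
  @sphere R 4 a /\
  ((sphere_differentiable (@section_volume R) a /\
    sphere_differential_vanishes (@section_volume R) a) \/
   ~ sphere_differentiable (@section_volume R) a).

Definition k_diagonal (R : realType) (k : nat) (a : 'rV[R]_4) : Prop :=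
  exists (s : 'S_4) (e : 'I_4 -> bool), forall i : 'I_4,
    a 0 (s i) = (-1) ^+ e i * (if (i < k)%N then (Num.sqrt k%:R)^-1 else 0).

Definition diagonal_direction (R : realType) (a : 'rV[R]_4) : Prop :=
  exists2 k : nat, (1 <= k <= 4)%N & k_diagonal k a.

(* Main.v *)
(** The vector is [a = (1, 1, 2, 2) / sqrt 10].  If [V] is not differentiable at
    [a] there is nothing to do; otherwise its differential is tested on three
    directions spanning the tangent space.  Along the great circles through
    [a] directed by [(1, -1, 0, 0)] and [(0, 0, 1, -1)], [V] is even, because
    exchanging two equal coordinates of [a] reverses the circle.  The third
    circle consists of vectors [(p, p, q, q)], for which
    [V = C * (3 * q - p) / q ^ 2] near [a], and this has derivative [0] at [a].

    The constant [C] need not be known, so neither the isodiametric inequality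
    nor the countable additivity of the Hausdorff measure [H] is used.  Only
    monotonicity, finite subadditivity and the scaling of [H] under
    similarities matter: with [c] the measure of a unit cube they give
    [H B <= c * vol B] for boxes, hence [H P <= c * vol P] for a polytope [P]
    cut into thin layers.  The same bound for [K `\` P], where the cube [K]
    contains [P] and has [H K = c * vol K] by scaling, yields equality.  If [c]
    is infinite then [H P] is infinite too, and [V], being [fine] of it,
    vanishes along the third circle. *)
Require Import Defs.
From mathcomp Require Import all_boot all_order all_algebra all_fingroup.
From mathcomp Require Import all_classical all_reals all_analysis.
From mathcomp Require Import ring lra.

Set Implicit Arguments.
Unset Strict Implicit.
Unset Printing Implicit Defensive.

Import Order.TTheory GRing.Theory Num.Theory.
Import numFieldNormedType.Exports.

Local Open Scope classical_set_scope.
Local Open Scope ring_scope.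

(** * Hausdorff measure as an outer measure *)

Lemma dotpZ (R : realType) n k (x y : 'rV[R]_n) :
  dotp (k *: x) y = k * dotp x y.
Proof. by rewrite /dotp mulr_sumr; apply: eq_bigr => i _; rewrite !mxE mulrA. Qed.

Lemma dotp_ge0 (R : realType) n (x : 'rV[R]_n) : 0 <= dotp x x.
Proof. by apply: sumr_ge0 => i _; rewrite -expr2 sqr_ge0. Qed.

Lemma enorm_eq0 (R : realType) n (x : 'rV[R]_n) : enorm x = 0 -> x = 0.
Proof.
move/eqP; rewrite sqrtr_eq0 => x0.
have /eqP : dotp x x = 0 by apply/le_anti; rewrite x0 dotp_ge0.
rewrite psumr_eq0 => [/allP z|i _]; last by rewrite -expr2 sqr_ge0.
apply/rowP => i; rewrite mxE; have := z i (mem_index_enum i).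
by rewrite -expr2 sqrf_eq0 => /eqP.
Qed.

(** Comparing squares keeps square roots out of the similarity computations. The dimensions may
    differ, as they do for the embedding of 3-space into 4-space. *)
Lemma enorm_scale (R : realType) m n (x : 'rV[R]_m) (y : 'rV[R]_n) l :
  0 <= l -> dotp y y = l ^+ 2 * dotp x x -> enorm y = l * enorm x.
Proof. by move=> l0 e; rewrite /enorm e sqrtrM ?sqr_ge0// sqrtr_sqr ger0_norm. Qed.

Lemma ediam_ge0 (R : realType) n (U : set 'rV[R]_n) : (0 <= ediam U)%E.
Proof. by apply: ereal_sup_ubound; left. Qed.

Lemma ediam_set0 (R : realType) n : ediam (@set0 'rV[R]_n) = 0%E.
Proof.
apply/le_anti; rewrite ediam_ge0 andbT; apply: ge_ereal_sup => z [->//|].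
by move=> [[x y] []].
Qed.

Lemma ediam_lipschitz (R : realType) m n (f : 'rV[R]_m -> 'rV[R]_n) l
    (A U : set 'rV[R]_m) : 0 < l ->
  (forall x y, A x -> A y -> enorm (f x - f y) <= l * enorm (x - y)) ->
  (ediam (f @` (U `&` A)) <= l%:E * ediam U)%E.
Proof.
move=> l0 lip; apply: ge_ereal_sup => z [->|].
  by rewrite mule_ge0 ?ediam_ge0// lee_fin ltW.
move=> [[x' y'] [[x [Ux Ax] /= <-] [y [Uy Ay] /= <-]] <-].
apply: (@le_trans _ _ (l%:E * (enorm (x - y))%:E)%E).
  by rewrite -EFinM lee_fin lip.
apply: lee_wpmul2l; first by rewrite lee_fin ltW.
apply: ereal_sup_ubound; right.
by exists (x, y).
Qed.

Lemma lee_cube (R : realType) (x y : \bar R) l : (0 <= l)%R ->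
  (0 <= x -> 0 <= y -> x <= l%:E * y -> x ^+ 3 <= (l ^+ 3)%:E * y ^+ 3)%E.
Proof.
move=> l0 x0 y0 xy.
have -> : ((l ^+ 3)%:E * y ^+ 3 = (l%:E * y) ^+ 3)%E.
  by rewrite EFin_expe !expeS !expe0 !mule1 muleACA (muleACA l%:E l%:E).
rewrite !expeS !expe0 !mule1.
by rewrite !lee_pmul// ?mule_ge0.
Qed.

Section HausdorffOuterMeasure.
Context {R : realType}.

Let term_ge0 n (U : nat -> set 'rV[R]_n) i :
  (0 <= (pi / 6)%:E * ediam (U i) ^+ 3)%E.
Proof. by rewrite mule_ge0 ?expe_ge0 ?ediam_ge0// lee_fin divr_ge0// pi_ge0. Qed.

Lemma hausdorff3_pre_ge0 n d (A : set 'rV[R]_n) : (0 <= hausdorff3_pre d A)%E.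
Proof. by apply: le_ereal_inf_tmp => _ [U _ <-]; apply: nneseries_ge0. Qed.

Lemma hausdorff3_pre_le n d (A : set 'rV[R]_n) :
  0 < d -> (hausdorff3_pre d A <= hausdorff3 A)%E.
Proof. by move=> d0; apply: ereal_sup_ubound; exists d. Qed.

Lemma hausdorff3_ge0 n (A : set 'rV[R]_n) : (0 <= hausdorff3 A)%E.
Proof. exact: le_trans (hausdorff3_pre_ge0 1 A) (hausdorff3_pre_le _ ltr01). Qed.

Lemma hausdorff3_le n (A B : set 'rV[R]_n) :
  A `<=` B -> (hausdorff3 A <= hausdorff3 B)%E.
Proof.
move=> AB; apply: ge_ereal_sup => _ [d d0 <-].
apply: le_trans (hausdorff3_pre_le _ d0).
apply: ereal_inf_le_tmp => _ [U [BU Ud] <-]; exists U => //; split => //.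
exact: subset_trans BU.
Qed.

Lemma hausdorff3_set0 n : hausdorff3 (@set0 'rV[R]_n) = 0%E.
Proof.
apply/le_anti; rewrite hausdorff3_ge0 andbT.
apply: ge_ereal_sup => _ [d /= d0 <-]; apply: ereal_inf_lbound.
exists (fun=> set0); first by split => // i; rewrite ediam_set0 lee_fin ltW.
by rewrite eseries0// => i _ _; rewrite ediam_set0 expeS mul0e mule0.
Qed.

(** Two covers, each within [e / 2] of its infimum, are interleaved into one sequence, at even and
    odd indices. *)
Lemma hausdorff3_pre_setU n d (A B : set 'rV[R]_n) :
  (hausdorff3_pre d (A `|` B) <= hausdorff3_pre d A + hausdorff3_pre d B)%E.
Proof.
have [fA|] := boolP (hausdorff3_pre d A \is a fin_num); last first.
  rewrite ge0_fin_numE ?hausdorff3_pre_ge0// -leNgt leye_eq => /eqP ->.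
  by rewrite addye ?leey// -ltNye (lt_le_trans _ (hausdorff3_pre_ge0 _ _)).
have [fB|] := boolP (hausdorff3_pre d B \is a fin_num); last first.
  rewrite ge0_fin_numE ?hausdorff3_pre_ge0// -leNgt leye_eq => /eqP ->.
  by rewrite addey ?leey// -ltNye (lt_le_trans _ (hausdorff3_pre_ge0 _ _)).
apply/lee_addgt0Pr => e e0.
have e20 : 0 < e / 2 by rewrite divr_gt0.
have [_ [U [AU Ud] <-] ltU] := lb_ereal_inf_adherent e20 fA.
have [_ [V [BV Vd] <-] ltV] := lb_ereal_inf_adherent e20 fB.
pose W i := if odd i then V i./2 else U i./2.
apply: (@le_trans _ _ (\sum_(0 <= i <oo) (pi / 6)%:E * ediam (W i) ^+ 3)%E).
  apply: ereal_inf_lbound; exists W => //; split => [x [/AU|/BV] [i _ xi]|i].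
  - by exists i.*2 => //; rewrite /W odd_double doubleK.
  - by exists i.*2.+1 => //; rewrite /W /= odd_double/= uphalf_double.
  - by rewrite /W; case: ifP.
have dbl N : (\sum_(0 <= i < N.*2) (pi / 6)%:E * ediam (W i) ^+ 3 =
    \sum_(0 <= i < N) (pi / 6)%:E * ediam (U i) ^+ 3 +
    \sum_(0 <= i < N) (pi / 6)%:E * ediam (V i) ^+ 3)%E.
  elim: N => [|N IH]; first by rewrite !big_geq// adde0.
  rewrite doubleS !big_nat_recr//= IH /W /= odd_double/= doubleK.
  by rewrite uphalf_double -addeA addeACA.
have -> : (hausdorff3_pre d A + hausdorff3_pre d B + e%:E =
    (hausdorff3_pre d A + (e / 2)%:E) + (hausdorff3_pre d B + (e / 2)%:E))%E.
  by rewrite addeACA -EFinD -splitr.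
apply: le_trans (leeD (ltW ltU) (ltW ltV)).
apply: lime_le; first exact: is_cvg_nneseries.
apply: nearW => N.
(* Passing from [N] to [N.*2] terms only increases the sum, and a sum of even length splits exactly
   into the two covers. *)
apply: (@le_trans _ _ (\sum_(0 <= i < N.*2) (pi / 6)%:E * ediam (W i) ^+ 3)%E).
  by apply: lee_sum_nneg_natr => //; rewrite -addnn leq_addr.
by rewrite dbl leeD// nneseries_lim_ge.
Qed.

Lemma hausdorff3_setU n (A B : set 'rV[R]_n) :
  (hausdorff3 (A `|` B) <= hausdorff3 A + hausdorff3 B)%E.
Proof.
apply: ge_ereal_sup => _ [d d0 <-].
by apply: le_trans (hausdorff3_pre_setU _ _ _) _; rewrite leeD// hausdorff3_pre_le.
Qed.

Lemma hausdorff3_cover (I : finType) n (A : set 'rV[R]_n) (B : I -> set 'rV[R]_n) :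
  (forall x, A x -> exists i, B i x) ->
  (hausdorff3 A <= \sum_i hausdorff3 (B i))%E.
Proof.
move=> AB.
apply: (@le_trans _ _ (hausdorff3 (\big[setU/set0]_i B i))).
  apply: hausdorff3_le => x /AB [i Bx].
  by rewrite (bigD1 i)//=; left.
elim/big_ind2 : _ => [|x1 x2 y1 y2 h1 h2|//]; first by rewrite hausdorff3_set0.
exact: le_trans (hausdorff3_setU _ _) (leeD h1 h2).
Qed.

(** A cover of [A] at scale [l^-1 * d] is carried by [f] to a cover of the image at scale [d], and
    each cubed diameter grows by at most [l ^+ 3]. *)
Lemma hausdorff3_lipschitz m n (f : 'rV[R]_m -> 'rV[R]_n) l (A : set 'rV[R]_m) :
  0 < l ->
  (forall x y, A x -> A y -> enorm (f x - f y) <= l * enorm (x - y)) ->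
  (hausdorff3 (f @` A) <= (l ^+ 3)%:E * hausdorff3 A)%E.
Proof.
move=> l0 lip; have l30 : 0 < l ^+ 3 by rewrite exprn_gt0.
apply: ge_ereal_sup => _ [d /= d0 <-].
have dl0 : 0 < l^-1 * d by rewrite mulr_gt0// invr_gt0.
rewrite -lee_pdivrMl//; apply: le_trans (hausdorff3_pre_le _ dl0).
apply: le_ereal_inf_tmp => _ [U [AU Ud] <-]; rewrite lee_pdivrMl//.
rewrite -nneseriesZl//.
apply: (@le_trans _ _
    (\sum_(0 <= i <oo) (pi / 6)%:E * ediam (f @` (U i `&` A)) ^+ 3)%E).
  (* The covering sets are first cut down to [A], since [f] is not controlled outside it. *)
  apply: ereal_inf_lbound; exists (fun i => f @` (U i `&` A)) => //; split.
    by move=> _ [x Ax <-]; have [i _ Ux] := AU _ Ax; exists i => //; exists x.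
  move=> i; apply: le_trans (ediam_lipschitz _ l0 lip) _.
  by rewrite -lee_pdivlMl.
apply: lee_nneseries => [i _ _|i _].
  exact: (term_ge0 (fun i => f @` (U i `&` A))).

rewrite [leRHS]muleCA; apply: lee_wpmul2l; first by rewrite lee_fin divr_ge0 ?pi_ge0.
by apply: lee_cube (ediam_lipschitz _ l0 lip); rewrite ?ediam_ge0// ltW.
Qed.

(** The inverse of [f] on the image is Lipschitz with constant [l^-1], which supplies the reverse
    inequality. *)
Lemma hausdorff3_similarity m n (f : 'rV[R]_m -> 'rV[R]_n) l (A : set 'rV[R]_m) :
  0 < l ->
  (forall x y, A x -> A y -> enorm (f x - f y) = l * enorm (x - y)) ->
  (hausdorff3 (f @` A) = (l ^+ 3)%:E * hausdorff3 A)%E.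
Proof.
move=> l0 sim; apply/le_anti/andP; split.
  by apply: hausdorff3_lipschitz => // x y Ax Ay; rewrite sim.
have injf x y : A x -> A y -> f x = f y -> x = y.
  move=> Ax Ay fxy; apply/eqP; rewrite -subr_eq0; apply/eqP/enorm_eq0.
  apply: (mulfI (lt0r_neq0 l0)); rewrite -sim// fxy subrr mulr0.
  by rewrite /enorm /dotp big1 ?sqrtr0// => i _; rewrite mxE mul0r.
(* The default value [0] is never met: [g] is only evaluated on the image of [A]. *)
pose g y := xget 0 [set x | A x /\ f x = y].
have gf x : A x -> g (f x) = x.
  move=> Ax; rewrite /g; case: xgetP => [_ -> [Az]|/(_ x) []//].
  exact: injf.
have lV0 : 0 < l^-1 by rewrite invr_gt0.
have := @hausdorff3_lipschitz _ _ g _ (f @` A) lV0.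
rewrite -lee_pdivlMl ?exprn_gt0// exprVn.
have -> : g @` (f @` A) = A.
  rewrite eqEsubset; split => [_ [_ [x Ax <-] <-]|x Ax]; first by rewrite gf.
  by exists (f x); [exists x|exact: gf].
apply => _ _ [x Ax <-] [y Ay <-]; rewrite !gf// sim// mulrA mulVf ?mul1r//.
exact: lt0r_neq0.
Qed.

End HausdorffOuterMeasure.

(** * Upper bounds by volume *)

(** Makes a subdivision into steps of size [N.+1%:R^-1] exact in the limit, once its total error is
    linear in the step. *)
Lemma lee_limit_harmonic (R : realType) (x : \bar R) (y M : R) :
  (forall N, (x <= (y + M * N.+1%:R^-1)%:E)%E) -> (x <= y%:E)%E.
Proof.
case: x => [x||] h; [|by have := h 0|by rewrite leNye].
rewrite lee_fin leNgt; apply/negP => yx.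
have d0 : 0 < x - y by rewrite subr_gt0.
have := archi_boundP (normr_ge0 (M / (x - y))); set N := Num.bound _ => ltN.
have N0 : 0 < N.+1%:R :> R by [].
have := h N; rewrite lee_fin -lerBlDl; apply/negP; rewrite -ltNge.
rewrite ltr_pdivrMr// -ltr_pdivrMl// mulrC.
apply: le_lt_trans (ler_norm _) (lt_trans ltN _).
by rewrite ltr_nat.
Qed.

Lemma hausdorff3_translate_scale (R : realType) m (u : 'rV[R]_m) e (A : set 'rV[R]_m) :
  0 < e ->
  hausdorff3 ((fun v => u + e *: v) @` A) = ((e ^+ 3)%:E * hausdorff3 A)%E.
Proof.
move=> e0; apply: hausdorff3_similarity => // x y _ _.
apply: enorm_scale; first exact: ltW.
have -> : u + e *: x - (u + e *: y) = e *: (x - y).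
  by rewrite opprD addrACA subrr add0r scalerBr.
by rewrite dotpZ /dotp !mulr_sumr; apply: eq_bigr => i _; rewrite !mxE; ring.
Qed.

Definition flip (R : realType) n (s : {ffun 'I_n -> bool}) (v : 'rV[R]_n) :=
  \row_i ((-1) ^+ s i * v 0 i).

Lemma hausdorff3_flip (R : realType) n (s : {ffun 'I_n -> bool}) (A : set 'rV[R]_n) :
  hausdorff3 (flip s @` A) = hausdorff3 A.
Proof.
rewrite (@hausdorff3_similarity _ _ _ _ 1) ?expr1n ?mul1e// => x y _ _.
apply: enorm_scale => //; rewrite expr1n mul1r; apply: eq_bigr => i _.
by rewrite !mxE; case: (s i); rewrite ?expr1 ?expr0; ring.
Qed.

(** Absolute values fold [A] into [B], so [A] is covered by reflected copies of [B], one for each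
    sign pattern and all of the same measure. *)
Lemma hausdorff3_orthants (R : realType) n (A B : set 'rV[R]_n) :
  (forall v, A v -> B (map_mx Num.norm v)) ->
  (hausdorff3 A <= (2 ^+ n)%:E * hausdorff3 B)%E.
Proof.
move=> AB; apply: (@le_trans _ _
    (\sum_(s : {ffun 'I_n -> bool}) hausdorff3 (flip s @` B))%E).
  apply: hausdorff3_cover => v Av; exists [ffun i => v 0 i < 0].
  exists (map_mx Num.norm v); first exact: AB.
  by apply/rowP => i; rewrite !mxE ffunE -numEsign.
rewrite (eq_bigr (fun=> hausdorff3 B)) => [|s _]; last exact: hausdorff3_flip.
rewrite sumr_const card_ffun card_bool card_ord -natrX mule_natl.
by elim: (2 ^ n)%N => [|k IH]; rewrite ?mulr0n ?mule0n// mulrS muleS leeD.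
Qed.

(** * Covering boxes by small cubes *)

Section Boxes.
Context {R : realType}.
Implicit Types (v : 'rV[R]_3) (S : set 'rV[R]_3).

Definition box (x1 x2 y1 y2 z1 z2 : R) : set 'rV[R]_3 :=
  [set v | [/\ x1 <= v 0 0 <= x2, y1 <= v 0 1 <= y2 & z1 <= v 0 2 <= z2]].

Definition vec3 (x y z : R) : 'rV[R]_3 := \row_i [:: x; y; z]`_i.

Definition unit_cube := box 0 1 0 1 0 1.

Lemma hausdorff3_cubical_box x y z e : 0 < e ->
  hausdorff3 (box x (x + e) y (y + e) z (z + e)) =
  ((e ^+ 3)%:E * hausdorff3 unit_cube)%E.
Proof.
move=> e0; rewrite -(hausdorff3_translate_scale (vec3 x y z))//; congr hausdorff3.
rewrite eqEsubset; split => [v [vx vy vz]|_ [v [vx vy vz] <-]]; last first.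
  have mid t a : 0 <= t <= 1 -> a <= a + e * t <= a + e.
    by move=> /andP[t0 t1]; rewrite lerDl mulr_ge0 ?(ltW e0)//= lerD2l ler_piMr ?(ltW e0).
  by split; rewrite !mxE/= mid.
exists (e^-1 *: (v - vec3 x y z)); last first.
  by rewrite scalerA divff ?lt0r_neq0// scale1r addrC subrK.
have mid a t : t <= a <= t + e -> 0 <= e^-1 * (a - t) <= 1.
  move=> /andP[ta at_]; rewrite mulr_ge0 ?subr_ge0 ?invr_ge0 ?(ltW e0)//=.
  by rewrite ler_pdivrMl// mulr1 lerBlDl.
by split; rewrite !mxE/= mid.
Qed.

(** The cell is found by truncating [(x - a) / e]. The additional cell accounts for an incomplete
    last one, and for [x = b] when [e] divides [b - a]. *)
Lemma cell_index (a b x e : R) : 0 < e -> a <= x <= b ->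
  exists k : 'I_(Num.truncn ((b - a) / e)).+1, a + k%:R * e <= x <= a + k%:R * e + e.
Proof.
move=> e0 /andP[ax xb].
have xe0 : 0 <= (x - a) / e by rewrite divr_ge0 ?subr_ge0// ltW.
have /andP[k1 k2] := truncn_itv xe0.
have lt_k : (Num.truncn ((x - a) / e) < (Num.truncn ((b - a) / e)).+1)%N.
  by rewrite ltnS le_truncn// ler_wpM2r ?invr_ge0 ?(ltW e0)// lerD2r.
exists (Ordinal lt_k) => /=.
move: k1 k2; rewrite ler_pdivlMr// ltr_pdivrMr// -natr1; lra.
Qed.

Lemma cell_count (a b e : R) : 0 < e -> a <= b ->
  (Num.truncn ((b - a) / e)).+1%:R * e <= b - a + e.
Proof.
move=> e0 ab; have h : 0 <= (b - a) / e by rewrite divr_ge0 ?subr_ge0// ltW.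
have /andP[k _] := truncn_itv h.
by move: k; rewrite ler_pdivlMr// -natr1; lra.
Qed.

Variable c : R.
Hypothesis cE : hausdorff3 unit_cube = c%:E.

Let c0 : 0 <= c.
Proof. by rewrite -lee_fin -cE hausdorff3_ge0. Qed.

(** A grid of cubes of side [e] covers the box and overshoots each of its sides by at most [e], so
    the excess volume vanishes with [e]. *)
Lemma hausdorff3_box_le x1 x2 y1 y2 z1 z2 : x1 <= x2 -> y1 <= y2 -> z1 <= z2 ->
  (hausdorff3 (box x1 x2 y1 y2 z1 z2) <=
   (c * ((x2 - x1) * (y2 - y1) * (z2 - z1)))%:E)%E.
Proof.
move=> x12 y12 z12; set a := x2 - x1; set b := y2 - y1; set d := z2 - z1.
have a0 : 0 <= a by rewrite subr_ge0.
have b0 : 0 <= b by rewrite subr_ge0.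
have d0 : 0 <= d by rewrite subr_ge0.
(* The last factor bounds [((a + e) * (b + e) * (d + e) - a * b * d) / e] when [e <= 1]. *)
apply: (@lee_limit_harmonic _ _ _ (c * (a * b + b * d + a * d + a + b + d + 1))).
move=> N; set e := N.+1%:R^-1.
have e0 : 0 < e by rewrite invr_gt0.
have e1 : e <= 1 by rewrite invf_le1// ler1n.
pose I := ('I_(Num.truncn (a / e)).+1 * 'I_(Num.truncn (b / e)).+1 *
  'I_(Num.truncn (d / e)).+1)%type.
pose cell (k : I) := box (x1 + k.1.1%:R * e) (x1 + k.1.1%:R * e + e)
  (y1 + k.1.2%:R * e) (y1 + k.1.2%:R * e + e)
  (z1 + k.2%:R * e) (z1 + k.2%:R * e + e).
apply: (@le_trans _ _ (\sum_k hausdorff3 (cell k))%E).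
  apply: hausdorff3_cover => v [vx vy vz].
  have [i ?] := cell_index e0 vx; have [j ?] := cell_index e0 vy.
  by have [k ?] := cell_index e0 vz; exists (i, j, k).
rewrite (eq_bigr (fun=> (e ^+ 3 * c)%:E)) => [|k _]; last first.
  by rewrite hausdorff3_cubical_box// cE.
rewrite sumEFin lee_fin sumr_const !card_prod !card_ord -mulr_natl !natrM.
have := cell_count e0 x12; have := cell_count e0 y12; have := cell_count e0 z12.
rewrite -/a -/b -/d.
set s := _.+1%:R; set q := _.+1%:R; set p := _.+1%:R => hs hq hp.
have p0 : 0 <= p * e by rewrite mulr_ge0// ltW.
have q0 : 0 <= q * e by rewrite mulr_ge0// ltW.
have s0 : 0 <= s * e by rewrite mulr_ge0// ltW.
have -> : p * q * s * (e ^+ 3 * c) = c * (p * e * (q * e) * (s * e)) by ring.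
rewrite -[X in _ <= _ + X]mulrA -mulrDr ler_wpM2l//.
apply: (@le_trans _ _ ((a + e) * (b + e) * (d + e))).
  by apply: ler_pM => //; [exact: mulr_ge0|exact: ler_pM].
have e2 : e * e <= e by rewrite ler_piMl ?(ltW e0).
have e3 : e * (e * e) <= e by rewrite ler_piMr ?(ltW e0)// (le_trans e2).
have := ler_wpM2l (addr_ge0 (addr_ge0 a0 b0) d0) e2.
nra.
Qed.

Lemma hausdorff3_layers N S (m : nat -> R) :
  (forall v, S v -> 0 <= v 0 2 <= 1) ->
  (forall k, (k < N.+1)%N -> (hausdorff3
     (S `&` [set v | (k%:R / N.+1%:R <= v 0 2 <= k.+1%:R / N.+1%:R)%R]) <= (m k)%:E)%E) ->
  (hausdorff3 S <= (\sum_(0 <= k < N.+1) m k)%:E)%E.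
Proof.
move=> S01 Sm; set e : R := N.+1%:R^-1.
have e0 : 0 < e by rewrite invr_gt0.
have N0 : 0 < N.+1%:R :> R by [].
apply: (@le_trans _ _ (\sum_(k < N.+1) hausdorff3
    (S `&` [set v | (k%:R * e <= v 0 2 <= k.+1%:R * e)%R]))%E).
  apply: hausdorff3_cover => v Sv; have /andP[z0 z1] := S01 _ Sv.
  (* The top layer is treated apart: at height [1], truncation would give the index [N.+1], which is
     out of range. *)
  have [zN|Nz] := ltP (v 0 2) (N%:R * e).
    have zE : 0 <= v 0 2 * N.+1%:R by rewrite mulr_ge0.
    have /andP[] := truncn_itv zE; set k := Num.truncn _ => k1 k2.
    have lt_k : (k < N.+1)%N.
      rewrite -(ltr_nat R); apply: le_lt_trans k1 _.
      rewrite -ltr_pdivlMr//; apply: lt_trans zN _.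
      by rewrite ltr_pM2r// ltr_nat.
    exists (Ordinal lt_k); split => //=.
    by rewrite ler_pdivrMr// ler_pdivlMr// k1 ltW.
  by exists ord_max; split => //=; rewrite Nz/= divff ?lt0r_neq0.
by rewrite big_mkord -sumEFin lee_sum// => k _; apply: Sm.
Qed.

End Boxes.

(** * Measure of the bipyramid by slicing *)

Section Bipyramid.
Context {R : realType}.
Implicit Types (v : 'rV[R]_3) (S : set 'rV[R]_3).

(** A Riemann sum: over [N.+1] equal layers the increments of [G] telescope, and the quadratic
    errors add up to [K / N.+1%:R]. *)
Lemma hausdorff3_le_integral S (G : R -> R) (K : R) :
  (forall v, S v -> 0 <= v 0 2 <= 1) ->
  (forall a b : R, 0 <= a -> a <= b -> b <= 1 ->
    (hausdorff3 (S `&` [set v | (a <= v 0 2 <= b)%R]) <=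
     (G b - G a + K * (b - a) ^+ 2)%:E)%E) ->
  (hausdorff3 S <= (G 1 - G 0)%:E)%E.
Proof.
move=> S01 SG; apply: (@lee_limit_harmonic _ _ _ K) => N.
set e : R := N.+1%:R^-1.
have N0 : 0 < N.+1%:R :> R by [].
have e0 : 0 < e by rewrite invr_gt0.
have eN : e * N.+1%:R = 1 by rewrite mulVf// lt0r_neq0.
pose m k := G (k.+1%:R / N.+1%:R) - G (k%:R / N.+1%:R) + K * e ^+ 2.
apply: (le_trans (@hausdorff3_layers _ N S m S01 _)) => [k kN|].
  have stepE : k.+1%:R / N.+1%:R - k%:R / N.+1%:R = e.
    by rewrite -mulrBl -natr1 addrAC subrr add0r mul1r.
  rewrite /m -stepE; apply: SG; first by rewrite divr_ge0.
    by rewrite -subr_ge0 stepE ltW.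
  by rewrite ler_pdivrMr// mul1r ler_nat.
rewrite lee_fin big_split/= telescope_sumr// mul0r divff ?lt0r_neq0//.
rewrite big_const_nat subn0 iter_addr_0 -[_ *+ N.+1]mulr_natr.
have -> : K * e ^+ 2 * N.+1%:R = K * e * (e * N.+1%:R) by ring.
by rewrite eN mulr1.
Qed.

(* Up to a similarity, the section of the cube by the hyperplane orthogonal to
   [(p, p, q, q)], with [r = p / q] and [rho = sqrt 2 * q]. *)
Definition bipyramid (rho r : R) : set 'rV[R]_3 :=
  [set v | `|v 0 0| <= rho * (1 - `|v 0 2|) /\ `|v 0 1| <= rho * (1 - r * `|v 0 2|)].

Definition bipyramid_octant (rho r : R) : set 'rV[R]_3 :=
  [set v | [/\ 0 <= v 0 0 <= rho * (1 - v 0 2),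
               0 <= v 0 1 <= rho * (1 - r * v 0 2) & 0 <= v 0 2 <= 1]].

Variables (c rho r : R).
Hypothesis cE : hausdorff3 unit_cube = c%:E.
Hypotheses (rho0 : 0 < rho) (rho1 : rho <= 1) (r0 : 0 <= r) (r1 : r <= 1).

Let c0 : 0 <= c.
Proof. by rewrite -lee_fin -cE hausdorff3_ge0. Qed.

(* Primitive of the cross-sectional area [(1 - z) * (1 - r * z)] (in units of [rho ^+ 2]). *)
Let G (z : R) : R := z - (1 + r) * z ^+ 2 / 2 + r * z ^+ 3 / 3.

Let rho2 : rho * rho <= 1.
Proof. by rewrite (le_trans _ rho1)// ler_piMr ?(ltW rho0). Qed.

(** The cross-sectional area decreases with height, so its value at the lower end overestimates the
    integral, with an error quadratic in the thickness. *)
Let G_below (a b : R) : 0 <= a -> a <= b -> b <= 1 ->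
  (1 - a) * (1 - r * a) * (b - a) <= G b - G a + (b - a) ^+ 2.
Proof.
move=> a0 ab b1; rewrite -subr_ge0.
have -> : G b - G a + (b - a) ^+ 2 - (1 - a) * (1 - r * a) * (b - a) =
  (b - a) ^+ 2 * ((1 - r) / 2 + r * a + r * (b - a) / 3) by rewrite /G; field.
apply: mulr_ge0; first exact: sqr_ge0.
by rewrite !addr_ge0 ?divr_ge0 ?mulr_ge0// subr_ge0.
Qed.

(** The counterpart at the upper end, where the area is smallest; [rho ^+ 2 <= 1] makes the error
    independent of [rho]. *)
Let G_above (a b : R) : 0 <= a -> a <= b -> b <= 1 ->
  rho ^+ 2 * (G b - G a) <= rho ^+ 2 * ((1 - b) * (1 - r * b) * (b - a)) + 2 * (b - a) ^+ 2.
Proof.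
move=> a0 ab b1; rewrite -lerBlDl -mulrBr.
have -> : G b - G a - (1 - b) * (1 - r * b) * (b - a) =
  (b - a) ^+ 2 * ((1 + r) / 2 - r * b + r * (b - a) / 3) by rewrite /G; field.
rewrite mulrCA [leRHS]mulrC ler_wpM2l ?sqr_ge0//.
have rb : r * (b - a) <= 1 by rewrite mulr_ile1// ?subr_ge0//; lra.
have rb0 : 0 <= r * b by rewrite mulr_ge0//; lra.
have rb1 : r * b <= r by rewrite ler_piMr.
have rba : 0 <= r * (b - a) by rewrite mulr_ge0 ?subr_ge0.
have q0 : 0 <= (1 + r) / 2 - r * b + r * (b - a) / 3 by have := r1; lra.
apply: (@le_trans _ _ (1 * ((1 + r) / 2 - r * b + r * (b - a) / 3))); last by have := r1; lra.
by rewrite ler_wpM2r// expr2.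
Qed.

Let G10 : G 1 - G 0 = (3 - r) / 6.
Proof. by rewrite /G; field. Qed.

(** Each layer lies in the box built on its lowest, hence largest, cross-section. *)
Lemma hausdorff3_octant_le :
  (hausdorff3 (bipyramid_octant rho r) <= (c * (rho ^+ 2 * ((3 - r) / 6)))%:E)%E.
Proof.
pose G' z := c * (rho ^+ 2 * G z).
have -> : c * (rho ^+ 2 * ((3 - r) / 6)) = G' 1 - G' 0.
  by rewrite /G' -!mulrBr G10.
apply: (@hausdorff3_le_integral _ _ (c * rho ^+ 2)) => [v []//|a b a0 ab b1].
have ra1 : r * a <= 1 by rewrite mulr_ile1//; lra.
have h1 : 0 <= rho * (1 - a) by rewrite mulr_ge0 ?(ltW rho0)//; lra.
have h2 : 0 <= rho * (1 - r * a) by rewrite mulr_ge0 ?(ltW rho0)//; lra.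
apply: (le_trans (hausdorff3_le _)); last first.
  apply: (le_trans (hausdorff3_box_le cE h1 h2 ab)).
  have -> : G' b - G' a + c * rho ^+ 2 * (b - a) ^+ 2 =
    c * (rho ^+ 2 * (G b - G a + (b - a) ^+ 2)) by rewrite /G'; ring.
  rewrite lee_fin ler_wpM2l//.
  have -> : (rho * (1 - a) - 0) * (rho * (1 - r * a) - 0) * (b - a) =
    rho ^+ 2 * ((1 - a) * (1 - r * a) * (b - a)) by ring.
  by rewrite ler_wpM2l ?sqr_ge0// G_below.
move=> v [[/andP[x0 xv] /andP[y0 yv] _] /= /andP[az zb]]; split => /=.
- by rewrite x0 (le_trans xv)// ler_wpM2l ?(ltW rho0)//; lra.
- rewrite y0 (le_trans yv)// ler_wpM2l ?(ltW rho0)// lerD2l lerN2.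
  exact: ler_wpM2l.
- by rewrite az.
Qed.

(** Each layer of the octant contains the box on its top cross-section, with sides [A] and [B]. The
    rest of the layer of the cube is covered by two boxes, of total base area
    [(1 - A) + A * (1 - B) = 1 - A * B]. *)
Lemma hausdorff3_octant_compl_le :
  (hausdorff3 (unit_cube `\` bipyramid_octant rho r) <=
   (c * (1 - rho ^+ 2 * ((3 - r) / 6)))%:E)%E.
Proof.
pose G' z := c * (z - rho ^+ 2 * G z).
have -> : c * (1 - rho ^+ 2 * ((3 - r) / 6)) = G' 1 - G' 0.
  by rewrite /G' -G10; ring.
apply: (@hausdorff3_le_integral _ _ (c * 2)) => [v [[]//]|a b a0 ab b1].
pose A := rho * (1 - b); pose B := rho * (1 - r * b).
have rb1 : r * b <= 1 by rewrite mulr_ile1//; lra.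
have rb0 : 0 <= r * b by rewrite mulr_ge0//; lra.
have A0 : 0 <= A by rewrite mulr_ge0 ?(ltW rho0)//; lra.
have B0 : 0 <= B by rewrite mulr_ge0 ?(ltW rho0)//; lra.
have A1 : A <= 1 by rewrite mulr_ile1// ?(ltW rho0)//; lra.
have B1 : B <= 1 by rewrite mulr_ile1// ?(ltW rho0)//; lra.
apply: (le_trans (@hausdorff3_le _ _ _ (box A 1 0 1 a b `|` box 0 A B 1 a b) _)).
  move=> v [[[/andP[x0 x1] /andP[y0 y1] /andP[z0 z1]] nP] /= /andP[az zb]].
  have [Ax|xA] := leP A (v 0 0); first by left; split; apply/andP.
  right; split; first (by rewrite x0 ltW); last by rewrite az.
  rewrite y1 andbT leNgt; apply/negP => yB; apply: nP; split.
  - rewrite x0 (le_trans (ltW xA))// ler_wpM2l ?(ltW rho0)//; lra.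
  - rewrite y0 (le_trans (ltW yB))// ler_wpM2l ?(ltW rho0)// lerD2l lerN2.
    exact: ler_wpM2l.
  - by rewrite z0.
apply: (le_trans (hausdorff3_setU _ _)).
have h1 := hausdorff3_box_le cE A1 ler01 ab.
have h2 := hausdorff3_box_le cE A0 B1 ab.
apply: (le_trans (leeD h1 h2)).
have -> : G' b - G' a + c * 2 * (b - a) ^+ 2 =
  c * (b - a - rho ^+ 2 * (G b - G a) + 2 * (b - a) ^+ 2) by rewrite /G'; ring.
rewrite -EFinD lee_fin -mulrDr ler_wpM2l//.
have := G_above a0 ab b1; rewrite /A /B; lra.
Qed.

Lemma unit_cube_corner v : box (-1) 1 (-1) 1 (-1) 1 v -> unit_cube (map_mx Num.norm v).
Proof. by case=> *; split; rewrite !mxE normr_ge0 ler_norml. Qed.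

(** The upper bound is eight times that of the octant. For the lower bound, the cube of side 2 has
    measure exactly [8 * c], from which the bound for the complement is subtracted. *)
Lemma hausdorff3_bipyramid :
  hausdorff3 (bipyramid rho r) = (c * (8 * (rho ^+ 2 * ((3 - r) / 6))))%:E.
Proof.
have two3 : (2 ^+ 3 : R) = 8 by rewrite -natrX.
apply/le_anti/andP; split.
  apply: (@le_trans _ _ ((2 ^+ 3)%:E * hausdorff3 (bipyramid_octant rho r))%E).
    apply: hausdorff3_orthants => v [hx hy].
    split; rewrite !mxE normr_ge0//=.
    (* The height bound is implicit in [bipyramid]: the right-hand side of [hx] dominates an
       absolute value, so [1 - z] is nonnegative for the folded height [z]. *)
    by rewrite -subr_ge0 -(pmulr_rge0 _ rho0) (le_trans _ hx).
  rewrite two3 mulrCA EFinM; apply: lee_wpmul2l; first by rewrite lee_fin.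
  exact: hausdorff3_octant_le.
have K : (8 * c)%:E = hausdorff3 (box (-1) 1 (-1) 1 (-1) (1 : R)).
  have := @hausdorff3_cubical_box R (-1) (-1) (-1) 2 (ltr0Sn _ 1).
  have -> : -1 + 2 = 1 :> R by ring.
  by move->; rewrite cE two3.
have : (hausdorff3 (box (-1) 1 (-1) 1 (-1) (1 : R)) <= hausdorff3 (bipyramid rho r) +
    (8 * (c * (1 - rho ^+ 2 * ((3 - r) / 6))))%:E)%E.
  apply: (@le_trans _ _ (hausdorff3 (bipyramid rho r `|`
      (box (-1) 1 (-1) 1 (-1) 1 `\` bipyramid rho r)))).
    by apply: hausdorff3_le => v Kv; have [?|?] := pselect (bipyramid rho r v); [left|right].
  apply: (le_trans (hausdorff3_setU _ _)); rewrite leeD2l//.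
  apply: (@le_trans _ _ ((2 ^+ 3)%:E *
      hausdorff3 (unit_cube `\` bipyramid_octant rho r))%E).
    apply: hausdorff3_orthants => v [Kv nPv]; split; first exact: unit_cube_corner.
    move=> [/andP[_ hx] /andP[_ hy] _]; apply: nPv; split; first by rewrite !mxE in hx.
    by rewrite !mxE in hy.
  rewrite two3 EFinM; apply: lee_wpmul2l; first by rewrite lee_fin.
  exact: hausdorff3_octant_compl_le.
rewrite -K -leeBlDr// -EFinB; apply: le_trans; rewrite lee_fin; lra.
Qed.

End Bipyramid.

(** The bipyramid contains a cube of side [rho / 2], which has infinite measure by scaling. *)
Lemma hausdorff3_bipyramid_infinite (R : realType) (rho r : R) :
  0 < rho -> rho <= 1 -> 0 <= r -> r <= 1 ->
  hausdorff3 (@unit_cube R) = +oo%E -> hausdorff3 (bipyramid rho r) = +oo%E.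
Proof.
move=> rho0 rho1 r0 r1 oo; apply/eqP; rewrite -leye_eq.
have e0 : 0 < rho / 2 by rewrite divr_gt0.
have <- : hausdorff3 (box 0 (0 + rho / 2) 0 (0 + rho / 2) 0 (0 + rho / 2)) = +oo%E.
  by rewrite hausdorff3_cubical_box// oo gt0_muley// lte_fin exprn_gt0.
apply: hausdorff3_le => v; rewrite !add0r => -[/andP[x0 x1] /andP[y0 y1] /andP[z0 z1]].
rewrite /bipyramid/= !ger0_norm//; split.
  apply: (le_trans x1); rewrite ler_wpM2l ?(ltW rho0)//; lra.
have rz : r * v 0 2 <= v 0 2 by rewrite ler_piMl.
apply: (le_trans y1); rewrite ler_wpM2l ?(ltW rho0)//; lra.
Qed.

(** * Sections orthogonal to (p, p, q, q) *)

Section SectionVolume.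
Context {R : realType}.

Definition vec4 (x y z w : R) : 'rV[R]_4 := \row_i [:: x; y; z; w]`_i.

Lemma row4P (u v : 'rV[R]_4) : u 0 0 = v 0 0 -> u 0 1 = v 0 1 ->
  u 0 2 = v 0 2 -> u 0 3 = v 0 3 -> u = v.
Proof.
move=> h0 h1 h2 h3; apply/rowP => -[[|[|[|[|//]]]] lt_i].
- by rewrite (_ : Ordinal lt_i = 0)//; apply/val_inj.
- by rewrite (_ : Ordinal lt_i = 1)//; apply/val_inj.
- by rewrite (_ : Ordinal lt_i = 2)//; apply/val_inj.
- by rewrite (_ : Ordinal lt_i = 3)//; apply/val_inj.
Qed.

Lemma dotp4 (u v : 'rV[R]_4) : dotp u v =
  u 0 0 * v 0 0 + u 0 1 * v 0 1 + u 0 2 * v 0 2 + u 0 3 * v 0 3.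
Proof.
rewrite /dotp !big_ord_recr big_ord0/= add0r.
do 3?[congr (_ + _)]; congr (_ * _); congr (fun_of_matrix _ _); exact/val_inj.
Qed.

Lemma dotp3 (u v : 'rV[R]_3) : dotp u v =
  u 0 0 * v 0 0 + u 0 1 * v 0 1 + u 0 2 * v 0 2.
Proof.
rewrite /dotp !big_ord_recr big_ord0/= add0r.
do 2?[congr (_ + _)]; congr (_ * _); congr (fun_of_matrix _ _); exact/val_inj.
Qed.

Lemma cube4 (u : 'rV[R]_4) : cube u <->
  [/\ -1 <= u 0 0 <= 1, -1 <= u 0 1 <= 1, -1 <= u 0 2 <= 1 & -1 <= u 0 3 <= 1].
Proof.
split=> [h|[h0 h1 h2 h3]]; first by split; apply: h.
move=> -[[|[|[|[|//]]]] lt_i].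
- by rewrite (_ : Ordinal lt_i = 0)//; apply/val_inj.
- by rewrite (_ : Ordinal lt_i = 1)//; apply/val_inj.
- by rewrite (_ : Ordinal lt_i = 2)//; apply/val_inj.
- by rewrite (_ : Ordinal lt_i = 3)//; apply/val_inj.
Qed.

Lemma sphere_dotp n (u : 'rV[R]_n) : dotp u u = 1 -> sphere u.
Proof. by move=> h; rewrite /sphere/= /enorm h sqrtr1. Qed.

(** Permuting coordinates is an isometry that preserves the cube and carries one hyperplane to the
    other. *)
Lemma section_volume_col_perm (s : 'S_4) (a : 'rV[R]_4) :
  section_volume (col_perm s a) = section_volume a.
Proof.
rewrite /section_volume; congr fine.
have perm_dotp x y : dotp (col_perm s x) (col_perm s y) = dotp x y :> R.
  by rewrite {2}/dotp (reindex_inj (@perm_inj _ s)); apply: eq_bigr => i _; rewrite !mxE.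
rewrite -[RHS]mul1e -(expr1n R 3).
rewrite -(@hausdorff3_similarity R _ _ (col_perm s) 1)// => [|x y _ _].
  congr hausdorff3; rewrite eqEsubset; split => [x [Cx Ox]|_ [x [Cx Ox] <-]].
    have xE : col_perm s (col_perm s^-1 x) = x.
      by apply/rowP => i; rewrite !mxE permK.
    exists (col_perm s^-1 x) => //; split; first by move=> i; rewrite mxE.
    by rewrite /orth/= -perm_dotp xE.
  by split; [move=> i; rewrite mxE|rewrite /orth/= perm_dotp].
apply: enorm_scale => //; rewrite expr1n mul1r -[RHS]perm_dotp.
by congr dotp; apply/rowP => i; rewrite !mxE.
Qed.

(** Two cube constraints on a pair of coordinates become one constraint on their half-difference [a]
    and half-sum [b]. *)
Lemma norm_le_compl (a b : R) :
  `|a| <= 1 - `|b| <-> -1 <= a + b <= 1 /\ -1 <= - a + b <= 1.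
Proof.
split=> [|[/andP[h1 h2] /andP[h3 h4]]].
  have [a0|a0] := ger0P a; have [b0|b0] := ger0P b => h;
  by split; apply/andP; split; lra.
by have [a0|a0] := ger0P a; have [b0|b0] := ger0P b; lra.
Qed.

(** The axes go to multiples of [(1, -1, 0, 0)], [(0, 0, 1, -1)] and [(1, 1, -r, -r)], which are
    mutually orthogonal and, for [r = p / q], orthogonal to [(p, p, q, q)]. *)
Definition bipyramid_embedding (rho r : R) (v : 'rV[R]_3) : 'rV[R]_4 :=
  vec4 (v 0 0 / rho + v 0 2) (- (v 0 0 / rho) + v 0 2)
       (v 0 1 / rho - r * v 0 2) (- (v 0 1 / rho) - r * v 0 2).

(** In half-sums and half-differences of the two pairs, orthogonality makes the second half-sum
    [- (p / q)] times the first. Here [rho] is a free scale, fixed later to get a similarity. *)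
Lemma section_bipyramid (p q rho : R) : 0 < rho -> 0 < p -> 0 < q ->
  cube (n:=4) `&` orth (vec4 p p q q) =
  bipyramid_embedding rho (p / q) @` bipyramid rho (p / q).
Proof.
move=> rho0 p0 q0; have rho_n0 := lt0r_neq0 rho0; have q_n0 := lt0r_neq0 q0.
have r0 : 0 <= p / q by rewrite divr_ge0 ?ltW.
have scaleE (t s : R) : (`|t| <= rho * (1 - s)) = (`|t / rho| <= 1 - s).
  by rewrite normrM normfV (gtr0_norm rho0) ler_pdivrMr// mulrC.
have bipE (v : 'rV[R]_3) : bipyramid rho (p / q) v <->
    `|v 0 0 / rho| <= 1 - `|v 0 2| /\ `|v 0 1 / rho| <= 1 - `|- (p / q * v 0 2)|.
  by rewrite /bipyramid/= !scaleE normrN (normrM (p / q)) (ger0_norm r0).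
rewrite eqEsubset; split => [u [/cube4[u0 u1 u2 u3] uO]|_ [v /bipE[h1 h2] <-]].
  move: uO; rewrite /orth/= dotp4 !mxE/= => uO.
  pose v := vec3 (rho * ((u 0 0 - u 0 1) / 2)) (rho * ((u 0 2 - u 0 3) / 2))
                 ((u 0 0 + u 0 1) / 2).
  have divK (t : R) : rho * t / rho = t by rewrite mulrC mulKf.
  have rz : - (p / q * ((u 0 0 + u 0 1) / 2)) = (u 0 2 + u 0 3) / 2.
    have -> : u 0 2 + u 0 3 = - (p / q) * (u 0 0 + u 0 1).
      by apply: (mulfI q_n0); rewrite mulNr mulrN mulrA [q * (p / q)]mulrC divfK//; lra.
    by ring.
  exists v.
    apply/bipE; rewrite !mxE/= !divK rz; split; apply/norm_le_compl.
      by split; apply/andP; split; lra.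
    by split; apply/andP; split; lra.
  by apply: row4P; rewrite !mxE/= !divK ?rz; lra.
have [a1 a2] := (norm_le_compl _ _).1 h1; have [b1 b2] := (norm_le_compl _ _).1 h2.
split; first by apply/cube4; rewrite !mxE/=.
by rewrite /orth/= dotp4 !mxE/=; field; rewrite ?rho_n0 ?q_n0.
Qed.

(** With this [rho] the images of the three orthogonal axes all have length [q^-1]: the squares are
    [2 / rho ^+ 2], twice, and [2 + 2 * (p / q) ^+ 2]. *)
Lemma bipyramid_embedding_similarity (p q rho : R) (x y : 'rV[R]_3) :
  0 < q -> rho != 0 -> rho ^+ 2 = 2 * q ^+ 2 -> 2 * p ^+ 2 + 2 * q ^+ 2 = 1 ->
  enorm (bipyramid_embedding rho (p / q) x - bipyramid_embedding rho (p / q) y) =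
  q^-1 * enorm (x - y).
Proof.
move=> q0 rho_n0 rho2 pq; have q_n0 := lt0r_neq0 q0.
apply: enorm_scale; first by rewrite invr_ge0 ltW.
rewrite dotp4 dotp3 !mxE/=.
set X := x 0 0 - y 0 0; set Y := x 0 1 - y 0 1; set Z := x 0 2 - y 0 2.
transitivity (2 / rho ^+ 2 * (X ^+ 2 + Y ^+ 2) +
    (2 * p ^+ 2 + 2 * q ^+ 2) / q ^+ 2 * Z ^+ 2).
  by rewrite /X /Y /Z; field; rewrite ?rho_n0 ?q_n0.
by rewrite rho2 pq; field.
Qed.

Lemma section_volume_two_pairs : exists C : R, forall p q : R,
  0 < p -> p <= q -> 2 * p ^+ 2 + 2 * q ^+ 2 = 1 ->
  section_volume (vec4 p p q q) = C * ((3 * q - p) / q ^+ 2).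
Proof.
have main (p q : R) : 0 < p -> p <= q -> 2 * p ^+ 2 + 2 * q ^+ 2 = 1 ->
    exists rho : R, [/\ 0 < rho, rho <= 1, rho ^+ 2 = 2 * q ^+ 2 &
      section_volume (vec4 p p q q) =
      fine ((q^-1 ^+ 3)%:E * hausdorff3 (bipyramid rho (p / q)))%E].
  move=> p0 pq pq1; have q0 := lt_le_trans p0 pq.
  have rho0 : 0 < Num.sqrt 2 * q by rewrite mulr_gt0// sqrtr_gt0.
  have rho2 : (Num.sqrt 2 * q) ^+ 2 = 2 * q ^+ 2 by rewrite exprMn sqr_sqrtr.
  exists (Num.sqrt 2 * q); split => //.
    rewrite -(@ler_pXn2r _ 2) ?nnegrE ?(ltW rho0)// rho2 expr1n.
    by have := sqr_ge0 p; lra.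
  rewrite /section_volume (section_bipyramid rho0)//.
  rewrite (@hausdorff3_similarity _ _ _ _ q^-1) ?invr_gt0// => x y _ _.
  by apply: bipyramid_embedding_similarity => //; apply: lt0r_neq0.
have [fin|] := boolP (hausdorff3 (@unit_cube R) \is a fin_num).
  have cE := esym (fineK fin); set c := fine _ in cE.
  (* Substituting [rho ^+ 2 = 2 * q ^+ 2] into [q^-1 ^+ 3 * (8 * rho ^+ 2 * (3 - p / q) / 6)] gives
     [8 / 3 * (3 * q - p) / q ^+ 2]. *)
  exists (c * (8 / 3)) => p q p0 pq pq1.
  have [rho [rho0 rho1 rho2 ->]] := main _ _ p0 pq pq1.
  have q0 := lt_le_trans p0 pq; have q_n0 := lt0r_neq0 q0.
  rewrite (hausdorff3_bipyramid cE)//.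
  - by rewrite -EFinM/= rho2; field.
  - by rewrite divr_ge0// ltW.
  - by rewrite ler_pdivrMr// mul1r.
rewrite ge0_fin_numE ?hausdorff3_ge0// -leNgt leye_eq => /eqP oo.
(* [fine] sends [+oo] to [0], so the formula holds with constant [0]. *)
exists 0 => p q p0 pq pq1; rewrite mul0r.
have [rho [rho0 rho1 rho2 ->]] := main _ _ p0 pq pq1.
have q0 := lt_le_trans p0 pq.
rewrite hausdorff3_bipyramid_infinite//.
- by rewrite gt0_muley// lte_fin exprn_gt0// invr_gt0.
- by rewrite divr_ge0// ltW.
- by rewrite ler_pdivrMr// mul1r.
Qed.

End SectionVolume.

(** * Differentiation along great circles *)

Lemma is_derive_scalel (R : realType) (V : normedModType R) (f : R -> R) (w : V)
    (x l : R) :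
  is_derive x 1 f l -> is_derive x 1 (fun t => f t *: w) (l *: w).
Proof.
move=> [df fl]; have dfl := (derivable1_diffP _ _).1 df.
have dw := differentiableZl w dfl.
apply: DeriveDef; first exact/derivable1_diffP.
rewrite (deriveE _ dw) (diffZl w dfl) -fl (deriveE _ dfl)//.
Qed.

Lemma is_derive_along (R : realType) (V : normedModType R) (F : V -> R^o)
    (g : R -> V) (x : R) (w : V) :
  is_derive x 1 g w -> differentiable F (g x) ->
  is_derive x 1 (F \o g) ('d F (g x) w).
Proof.
move=> [dg gw] dF; have dgx := (derivable1_diffP _ _).1 dg.
have dFg := differentiable_comp dgx dF.
apply: DeriveDef; first exact/derivable1_diffP.
by rewrite (deriveE _ dFg) (diff_comp dgx dF) /= -(deriveE _ dgx) gw.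
Qed.

Section SphereCurves.
Context {R : realType}.

Definition great_circle (a v : 'rV[R]_4) (t : R) : 'rV[R]_4 := cos t *: a + sin t *: v.

Lemma great_circle_sphere (a v : 'rV[R]_4) t :
  dotp a a = 1 -> dotp v v = 1 -> dotp a v = 0 -> sphere (great_circle a v t).
Proof.
move=> aa vv av; apply: sphere_dotp.
have -> : dotp (great_circle a v t) (great_circle a v t) =
  cos t ^+ 2 * dotp a a + sin t ^+ 2 * dotp v v + 2 * (cos t * sin t) * dotp a v.
  by rewrite !dotp4 !mxE; ring.
by rewrite aa vv av !mulr1 mulr0 addr0 cos2Dsin2.
Qed.

Lemma great_circle_is_derive (F : 'rV[R]_4 -> R^o) (a v : 'rV[R]_4) :
  differentiable F a -> is_derive (0 : R) 1 (F \o great_circle a v) ('d F a v).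
Proof.
move=> dF.
have g0 : great_circle a v 0 = a by rewrite /great_circle cos0 sin0 scale1r scale0r addr0.
have dg : is_derive (0 : R) 1 (great_circle a v) v.
  have := is_deriveD (is_derive_scalel a (is_derive_cos (0 : R)))
                     (is_derive_scalel v (is_derive_sin (0 : R))).
  by rewrite sin0 cos0 oppr0 scale0r add0r scale1r.
have dFg : differentiable F (great_circle a v 0) by rewrite g0.
by have := is_derive_along dg dFg; rewrite g0.
Qed.

(** Reads the differential of an arbitrary extension [F] off its values on the sphere, where it is
    known. *)
Lemma diff_great_circle (F : 'rV[R]_4 -> R^o) (a v : 'rV[R]_4) (h : R -> R^o) (l : R^o) :
  differentiable F a -> (\forall t \near (0 : R), F (great_circle a v t) = h t) ->
  is_derive (0 : R) 1 h l -> 'd F a v = l.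
Proof.
move=> dF Fh dh.
have := near_eq_is_derive Fh (great_circle_is_derive v dF).
by case=> _ <-; case: dh.
Qed.

(** Evenness gives the same derivative along [- v] and [v], while linearity makes the two
    opposite. *)
Lemma diff_even_great_circle (F : 'rV[R]_4 -> R^o) (a v : 'rV[R]_4) :
  differentiable F a ->
  (forall t, F (great_circle a (- v) t) = F (great_circle a v t)) -> 'd F a v = 0.
Proof.
move=> dF even.
have : 'd F a (- v) = 'd F a v.
  apply: (diff_great_circle dF) (great_circle_is_derive v dF).
  exact: (@filterE _ (nbhs (0 : R)) _ _ even).
rewrite linearN => /eqP; rewrite eq_sym -subr_eq0 opprK -mulr2n -mulr_natr.
by rewrite mulf_eq0 pnatr_eq0 orbF => /eqP.
Qed.

End SphereCurves.

(** * The critical vector and its tangent space *)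

Section CriticalDirection.
Context {R : realType}.

Let s : R := (Num.sqrt 10)^-1.
Let d : R := (Num.sqrt 2)^-1.

Let s2 : s ^+ 2 = 10^-1.
Proof. by rewrite exprVn sqr_sqrtr. Qed.

Let d2 : d ^+ 2 = 2^-1.
Proof. by rewrite exprVn sqr_sqrtr. Qed.

Let s0 : 0 < s.
Proof. by rewrite invr_gt0 sqrtr_gt0. Qed.

Let d0 : 0 < d.
Proof. by rewrite invr_gt0 sqrtr_gt0. Qed.

Definition critical_vector : 'rV[R]_4 := vec4 s s (2 * s) (2 * s).

(** These three directions form an orthonormal basis of the tangent space; unit length keeps the
    great circles on the sphere. *)
Let dir_pair : 'rV[R]_4 := vec4 (2 * s) (2 * s) (- s) (- s).
Let dir01 : 'rV[R]_4 := vec4 d (- d) 0 0.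
Let dir23 : 'rV[R]_4 := vec4 0 0 d (- d).

Lemma dotp_critical_vector : dotp critical_vector critical_vector = 1.
Proof. by rewrite dotp4 !mxE/=; have := s2; lra. Qed.

(** All nonzero entries of a diagonal direction have the same square, whereas here both [s ^+ 2] and
    [4 * s ^+ 2] occur. *)
Lemma critical_vector_not_diagonal : ~ diagonal_direction critical_vector.
Proof.
move=> [k _ [t [e te]]].
have sqE i j : critical_vector 0 i != 0 -> critical_vector 0 j != 0 ->
    critical_vector 0 i ^+ 2 = critical_vector 0 j ^+ 2.
  have sqr_entry n : critical_vector 0 n != 0 ->
      critical_vector 0 n ^+ 2 = (Num.sqrt k%:R)^-1 ^+ 2.
    rewrite -[n](permKV t) te; case: ifP => _; last by rewrite mulr0 eqxx.
    by rewrite exprMn sqrr_sign mul1r.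
  by move=> /sqr_entry -> /sqr_entry ->.
have s_n0 := lt0r_neq0 s0.
have := sqE 0 2; rewrite !mxE/= mulf_neq0// => /(_ s_n0 isT).
by rewrite exprMn s2; lra.
Qed.

Let near0_pos (k : R) : \forall t \near (0 : R), 0 < cos t + k * sin t.
Proof.
have c : (cos t + k * sin t) @[t --> (0 : R)] --> cos 0 + k * sin (0 : R).
  apply: (@cvgD _ R^o _ _ _ cos (fun t => k * sin t)); first exact: continuous_cos.
  by apply: (@cvgMl_tmp R); exact: continuous_sin.
by have := cvgr_gt _ c; rewrite cos0 sin0 mulr0 addr0; apply.
Qed.

Lemma section_volume_pair_derive (F : 'rV[R]_4 -> R^o) :
  sphere_diff_extension (@section_volume R) critical_vector F ->
  'd F critical_vector dir_pair = 0.
Proof.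
move=> [FV dF]; have [C VC] := @section_volume_two_pairs R.
pose p t : R := s * (cos t + 2 * sin t).
pose q t : R := s * (2 * cos t - sin t).
have curve t : great_circle critical_vector dir_pair t = vec4 (p t) (p t) (q t) (q t).
  by apply: row4P; rewrite !mxE/= /p /q; ring.
apply: (diff_great_circle dF (h := fun t => C * ((3 * q t - p t) / q t ^+ 2))).
  near=> t.
  have t1 : 0 < cos t + 2 * sin t by near: t; exact: near0_pos.
  (* This is the sign of [q t - p t = s * (cos t - 3 * sin t)]; with [t1] it puts the curve in the
     range of the volume formula. *)
  have t2 : 0 < cos t + - 3 * sin t by near: t; exact: near0_pos.
  rewrite FV; last first.
    apply: great_circle_sphere; first exact: dotp_critical_vector.
      by rewrite dotp4 !mxE/=; have := s2; lra.
    by rewrite dotp4 !mxE/=; lra.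
  rewrite curve VC//.
  - by rewrite /p mulr_gt0.
  - by rewrite /p /q ler_pM2l//; lra.
  - have := cos2Dsin2 t; have := s2; rewrite /p /q !exprMn => ->.
    by nra.
have s_n0 := lt0r_neq0 s0.
have dp : is_derive (0 : R) 1 p (2 * s).
  have D := is_deriveZ s (is_deriveD (is_derive_cos (0 : R))
                                     (is_deriveZ 2 (is_derive_sin (0 : R)))).
  apply: (is_derive_eq D); rewrite sin0 cos0 oppr0 add0r.
  by rewrite -[LHS]/(s * (2 * 1)) mulr1 mulrC.
have dq : is_derive (0 : R) 1 q (- s).
  have D := is_deriveZ s (is_deriveB (is_deriveZ 2 (is_derive_cos (0 : R)))
                                     (is_derive_sin (0 : R))).
  apply: (is_derive_eq D); rewrite sin0 cos0 oppr0.
  by rewrite -[LHS]/(s * (2 * 0 - 1)) mulr0 sub0r mulrN1.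
have p0 : p 0 = s by rewrite /p cos0 sin0 mulr0 addr0 mulr1.
have q0 : q 0 = 2 * s by rewrite /q cos0 sin0 subr0 mulr1 mulrC.
have qq0 : (q * q) 0 != 0.
  by rewrite -[(q * q) 0]/(q 0 * q 0) q0 !mulf_neq0.
have D := is_deriveZ C (is_deriveM (is_deriveB (is_deriveZ 3 dq) dp)
                                   (is_deriveV qq0 (is_deriveM dq dq))).
apply: (is_derive_eq D).
(* The product rule, with [q ^+ 2] unfolded to [q * q]. At [p 0 = s] and [q 0 = 2 * s] its two terms
   are [5 / (4 * s)] and [- 5 / (4 * s)], up to the factor [C]. *)
rewrite -[LHS]/(C * ((3 * q 0 - p 0) * (- (q 0 * q 0) ^- 2 * (q 0 * - s + q 0 * - s))
  + (q 0 * q 0)^-1 * (3 * - s - 2 * s))) p0 q0.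
by field.
Unshelve. all: by end_near.
Qed.

(** The transposition fixes the base point and negates [w], so it carries the circle directed by [w]
    to the one directed by [- w]. *)
Lemma great_circle_swap (i j : 'I_4) (w : 'rV[R]_4) :
  col_perm (tperm i j) critical_vector = critical_vector ->
  col_perm (tperm i j) w = - w ->
  forall t, section_volume (great_circle critical_vector (- w) t) =
            section_volume (great_circle critical_vector w t).
Proof.
move=> ha hw t; rewrite -(section_volume_col_perm (tperm i j) (great_circle _ w t)).
congr section_volume; rewrite /great_circle -hw -{1}ha.
by apply/rowP => k; rewrite !mxE.
Qed.

Lemma critical_vector_critical : critical_direction critical_vector.
Proof.
split; first exact/sphere_dotp/dotp_critical_vector.
have [dV|] := pselect (sphere_differentiable (@section_volume R) critical_vector);
  [left; split => // F FV u uO|by right].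
have [FE dF] := FV.
have swap (i j : 'I_4) (w : 'rV[R]_4) : dotp w w = 1 -> dotp critical_vector w = 0 ->
    col_perm (tperm i j) critical_vector = critical_vector ->
    col_perm (tperm i j) w = - w -> 'd F critical_vector w = 0.
  move=> ww aw ha hw; apply: diff_even_great_circle => // t.
  have a1 := dotp_critical_vector.
  have wwN : dotp (- w) (- w) = 1 by rewrite -ww !dotp4 !mxE; ring.
  have awN : dotp critical_vector (- w) = 0 by rewrite -oppr0 -aw !dotp4 !mxE; ring.
  rewrite (FE _ (great_circle_sphere t a1 wwN awN)) (FE _ (great_circle_sphere t a1 ww aw)).
  exact: great_circle_swap ha hw t.
have d01 : 'd F critical_vector dir01 = 0.
  apply: (swap 0 1).
  - by rewrite dotp4 !mxE/=; have := d2; lra.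
  - by rewrite dotp4 !mxE/=; ring.
  - by apply: row4P; rewrite !mxE ?tpermL ?tpermR ?tpermD.
  - by apply: row4P; rewrite !mxE ?tpermL ?tpermR ?tpermD//= ?opprK ?oppr0.
have d23 : 'd F critical_vector dir23 = 0.
  apply: (swap 2 3).
  - by rewrite dotp4 !mxE/=; have := d2; lra.
  - by rewrite dotp4 !mxE/=; ring.
  - by apply: row4P; rewrite !mxE ?tpermL ?tpermR ?tpermD.
  - by apply: row4P; rewrite !mxE ?tpermL ?tpermR ?tpermD//= ?opprK ?oppr0.
have dpair := section_volume_pair_derive FV.
have d_n0 := lt0r_neq0 d0; have s_n0 := lt0r_neq0 s0.
have uO' : u 0 0 + u 0 1 + 2 * (u 0 2 + u 0 3) = 0.
  apply: (mulfI s_n0); rewrite mulr0; move: uO.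
  by rewrite /orth/= dotp4 !mxE/= => <-; ring.
(* The coefficients are the inner products of [u] with the basis, rewritten using [d ^+ 2 = 2^-1],
   [s ^+ 2 = 10^-1] and the orthogonality relation [uO']. *)
have -> : u = ((u 0 0 - u 0 1) / (2 * d)) *: dir01 + ((u 0 2 - u 0 3) / (2 * d)) *: dir23
    + ((u 0 0 + u 0 1) / (4 * s)) *: dir_pair.
  have e01 : u 0 0 + u 0 1 = - 2 * (u 0 2 + u 0 3) by lra.
  apply: row4P; rewrite !mxE/=.
  - by field; rewrite d_n0 s_n0.
  - by field; rewrite d_n0 s_n0.
  - by rewrite e01; field; rewrite d_n0 s_n0.
  - by rewrite e01; field; rewrite d_n0 s_n0.
by rewrite !linearD !linearZ d01 d23 dpair /= !scaler0 !addr0.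
Qed.

End CriticalDirection.

Theorem mainTheorem4 (R : realType) :
  exists a : 'rV[R]_4,
    critical_direction a /\ ~ diagonal_direction a.
Proof.
exists critical_vector.
by split; [exact: critical_vector_critical|exact: critical_vector_not_diagonal].
Qed.
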